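(* (1) Let $S$ be any quasi-countable inverse monoid. Then $S$ has uniformly bounded group distortion if and only if every $\sigma$-class contains finitely many maximal elements, and every ascending chain (in the natural partial order on $S$) is bounded above. (2) Let $S$ be any quasi-countable inverse semigroup. Then $S$ has uniformly bounded group distortion if and only if every $\sigma$-class contains finitely many maximal non-idempotent elements, and every ascending chain of non-idempotent elements (in the natural partial order on $S$) is bounded above.
   Context: An inverse semigroup is a semigroup $S$ in which every $s$ has a unique $s^{-1}$ with $ss^{-1}s=s$ and $s^{-1}ss^{-1}=s^{-1}$; an inverse monoid is an inverse semigroup with identity. $E(S)$ is its set of idempotents. The natural partial order is $s\le t$ iff $s=te$ for some $e\in E(S)$. Elements $s,t$ are $\mathcal{R}$-related iff $ss^{-1}=tt^{-1}$. $S$ is quasi-countable if there is a countable set $X$ of elements such that $S$ is generated, under multiplication and inversion (as an inverse semigroup, respectively inverse monoid), by $X\cup E(S)$. The maximal group image is $G=S/\sigma$, where $\sigma$ is the least congruence identifying all idempotents; $\sigma\colon S\to G$ also denotes the natural homomorphism. A standard metric on a quasi-countable inverse semigroup $S$ is an extended metric $d\colon S\times S\to[0,\infty]$ which is uniformly discrete (positive lower bound on distances between distinct points), has $d(s,t)<\infty$ iff $s,t$ are $\mathcal{R}$-related, is left subinvariant ($d(xs,xt)\le d(s,t)$ for all $s,t,x$) and proper (for every $r\ge0$ there is a finite $F\subseteq S$ with $y\in xF$ whenever $x\neq y$ and $d(x,y)\le r$). Every quasi-countable inverse semigroup (in particular every countable group) has a standard metric, unique up to coarse equivalence. With standard metrics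 $d_S$ on $S$ and $d_G$ on $G$, $S$ has uniformly bounded group distortion if there is a function $\phi\colon[0,\infty)\to[0,\infty)$ such that $d_S(s,t)\le\phi(d_G(\sigma(s),\sigma(t)))$ for every $\mathcal{R}$-class $R$ of $S$ and all $s,t\in R$. (This does not depend on the choice of standard metrics.) *)

(* Defs.v *)
From HB Require Import structures.
From mathcomp Require Import all_boot all_order all_algebra.
From mathcomp Require Import all_classical all_reals all_analysis.

Set Implicit Arguments.
Unset Strict Implicit.
Unset Printing Implicit Defensive.

Import Order.TTheory GRing.Theory Num.Theory.

Local Open Scope classical_set_scope.
Local Open Scope quotient_scope.
Local Open Scope group_scope.

(* The library's [inv] lives on [baseGroupType], which requires a unit; an
   inverse semigroup has none in general, hence a separate operation. *)
HB.mixin Record Semigroup_isInverse S of Semigroup S := {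
  sinv : S -> S;
  mulsVs : forall s : S, s * sinv s * s = s;
  mulVsV : forall s : S, sinv s * s * sinv s = sinv s;
  sinv_uniq : forall s t : S, s * t * s = s -> t * s * t = t -> t = sinv s
}.

#[short(type="invSemigroupType")]
HB.structure Definition InverseSemigroup :=
  {S of Semigroup_isInverse S & Semigroup S}.

#[short(type="invMonoidType")]
HB.structure Definition InverseMonoid := {S of InverseSemigroup S & Monoid S}.

Definition idempotents (S : invSemigroupType) : set S := [set e | e * e = e].
Arguments idempotents S : clear implicits.

Definition natural_le (S : invSemigroupType) (s t : S) : Prop :=
  exists2 e, idempotents S e & s = t * e.

Definition maximal_elt (S : invSemigroupType) (s : S) : Prop :=
  forall t, natural_le s t -> t = s.

Definition ascending_chain (S : invSemigroupType) (u : nat -> S) : Prop :=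
  forall n, natural_le (u n) (u n.+1).

Definition bounded_above (S : invSemigroupType) (u : nat -> S) : Prop :=
  exists b, forall n, natural_le (u n) b.

Definition greenR (S : invSemigroupType) (s t : S) : Prop :=
  s * sinv s = t * sinv t.

Definition inverse_subsemigroup (S : invSemigroupType) (A : set S) : Prop :=
  (forall s t, A s -> A t -> A (s * t)) /\ (forall s, A s -> A (sinv s)).

(* For an inverse monoid this is also generation as an inverse monoid, since
   the identity belongs to [idempotents S]. *)
Definition quasi_countable (S : invSemigroupType) : Prop :=
  exists2 X : set S, countable X &
    smallest (@inverse_subsemigroup S) (X `|` idempotents S) = setT.

Definition congruence (S : invSemigroupType) (rho : S -> S -> Prop) : Prop :=
  [/\ forall s, rho s s,
      forall s t, rho s t -> rho t s,
      forall s t u, rho s t -> rho t u -> rho s u &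
      forall s s' t t', rho s s' -> rho t t' -> rho (s * t) (s' * t')].

Definition sigma (S : invSemigroupType) (s t : S) : Prop :=
  forall rho, congruence rho ->
    (forall e f, idempotents S e -> idempotents S f -> rho e f) -> rho s t.

Lemma sigma_congruence (S : invSemigroupType) : congruence (@sigma S).
Proof.
split.
- by move=> s rho [].
- by move=> s t st rho crho Erho; case: (crho) => _ sy _ _; exact: sy (st _ crho Erho).
- move=> s t u st tu rho crho Erho; case: (crho) => _ _ tr _.
  by exact: tr (st _ crho Erho) (tu _ crho Erho).
- move=> s s' t t' ss' tt' rho crho Erho; case: (crho) => _ _ _; apply.
    exact: ss'.
  exact: tt'.
Qed.

Lemma sigma_idem (S : invSemigroupType) (e f : S) :
  idempotents S e -> idempotents S f -> sigma e f.
Proof. by move=> Ee Ef rho _; apply. Qed.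

Definition sigmab (S : invSemigroupType) : rel S := fun s t => `[< sigma s t >].

Lemma sigmab_refl (S : invSemigroupType) : reflexive (@sigmab S).
Proof. by move=> s; apply/asboolP; case: (sigma_congruence S). Qed.

Lemma sigmab_sym (S : invSemigroupType) : symmetric (@sigmab S).
Proof.
by move=> s t; apply/asboolP/asboolP; case: (sigma_congruence S) => _ + _ _; apply.
Qed.

Lemma sigmab_trans (S : invSemigroupType) : transitive (@sigmab S).
Proof.
move=> t s u /asboolP st /asboolP tu; apply/asboolP.
by case: (sigma_congruence S) => _ _ + _; apply; [exact: st|exact: tu].
Qed.

Canonical sigma_equiv (S : invSemigroupType) :=
  EquivRel (@sigmab S) (@sigmab_refl S) (@sigmab_sym S) (@sigmab_trans S).

Definition max_group_image (S : invSemigroupType) := {eq_quot (sigma_equiv S)}.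

HB.instance Definition _ (S : invSemigroupType) :=
  Choice.on (max_group_image S).

Definition sigma_hom (S : invSemigroupType) (s : S) : max_group_image S :=
  \pi_{eq_quot (sigma_equiv S)} s.

Definition mgi_mul (S : invSemigroupType) (g h : max_group_image S) :=
  sigma_hom (repr g * repr h).

Definition mgi_inv (S : invSemigroupType) (g : max_group_image S) :=
  sigma_hom (sinv (repr g)).

Lemma sigma_homP (S : invSemigroupType) (s t : S) :
  sigma_hom s = sigma_hom t <-> sigma s t.
Proof.
split=> [/eqmodP /asboolP //|st]; apply/eqmodP; exact/asboolP.
Qed.

Lemma sigma_hom_repr (S : invSemigroupType) (g : max_group_image S) :
  sigma_hom (repr g) = g.
Proof. exact: reprK. Qed.

Lemma mgi_mulE (S : invSemigroupType) (s t : S) :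
  mgi_mul (sigma_hom s) (sigma_hom t) = sigma_hom (s * t).
Proof.
apply/sigma_homP; case: (sigma_congruence S) => _ _ _; apply;
  exact/sigma_homP/sigma_hom_repr.
Qed.

Lemma mgi_mulA (S : invSemigroupType) : associative (@mgi_mul S).
Proof.
move=> g h k; rewrite -(sigma_hom_repr g) -(sigma_hom_repr h).
by rewrite -(sigma_hom_repr k) !mgi_mulE mulgA.
Qed.

HB.instance Definition _ (S : invSemigroupType) :=
  isSemigroup.Build (max_group_image S) (@mgi_mulA S).

Lemma sigma_homM (S : invSemigroupType) (s t : S) :
  sigma_hom (s * t) = sigma_hom s * sigma_hom t.
Proof. by rewrite -mgi_mulE. Qed.

Lemma idem_mulV (S : invSemigroupType) (s : S) : idempotents S (s * sinv s).
Proof. by rewrite /idempotents /= mulgA mulsVs. Qed.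

Lemma idem_mulVs (S : invSemigroupType) (s : S) : idempotents S (sinv s * s).
Proof. by rewrite /idempotents /= mulgA mulVsV. Qed.

Lemma sigma_hom_mul1 (S : invSemigroupType) (e : S) (g : max_group_image S) :
  idempotents S e -> sigma_hom e * g = g /\ g * sigma_hom e = g.
Proof.
move=> Ee; rewrite -(sigma_hom_repr g); set s := repr g; split.
  have /sigma_homP -> := sigma_idem Ee (idem_mulV s).
  by rewrite -sigma_homM mulsVs.
have /sigma_homP -> := sigma_idem Ee (idem_mulVs s).
by rewrite -sigma_homM mulgA mulsVs.
Qed.

Lemma mgi_mulsVs (S : invSemigroupType) (g : max_group_image S) :
  g * mgi_inv g * g = g.
Proof.
rewrite /mgi_inv; set s := repr g.
by rewrite -(sigma_hom_repr g) -/s -!sigma_homM mulsVs.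
Qed.

Lemma mgi_mulVsV (S : invSemigroupType) (g : max_group_image S) :
  mgi_inv g * g * mgi_inv g = mgi_inv g.
Proof.
rewrite /mgi_inv; set s := repr g.
by rewrite -(sigma_hom_repr g) -/s -!sigma_homM mulVsV.
Qed.

Lemma mgi_inv_uniq (S : invSemigroupType) (g h : max_group_image S) :
  g * h * g = g -> h * g * h = h -> h = mgi_inv g.
Proof.
move=> ghg _; set s := repr g; set i := mgi_inv g.
have [E1 _] := sigma_hom_mul1 h (idem_mulVs s).
have [_ E2] := sigma_hom_mul1 h (idem_mulV s).
rewrite -[LHS]E2 -[X in X * _]E1 !sigma_homM sigma_hom_repr -/(mgi_inv g) -/i.
by rewrite !mulgA -(mulgA i g h) -(mulgA i (g * h) g) ghg mgi_mulVsV.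
Qed.

HB.instance Definition _ (S : invSemigroupType) :=
  Semigroup_isInverse.Build (max_group_image S)
    (@mgi_mulsVs S) (@mgi_mulVsV S) (@mgi_inv_uniq S).

Definition sigma_class (S : invSemigroupType) (g : max_group_image S) : set S :=
  [set s | sigma_hom s = g].

Local Open Scope ereal_scope.

Definition extended_metric (R : realType) (T : Type) (d : T -> T -> \bar R) :=
  [/\ forall s t, 0 <= d s t,
      forall s t, d s t = 0 <-> s = t,
      forall s t, d s t = d t s &
      forall s t u, d s u <= d s t + d t u].

Definition uniformly_discrete (R : realType) (T : Type) (d : T -> T -> \bar R) :=
  exists2 eps : R, (0 < eps)%R & forall s t, s <> t -> eps%:E <= d s t.

Definition left_subinvariant (R : realType) (S : invSemigroupType)
    (d : S -> S -> \bar R) :=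
  forall s t x, d (x * s)%g (x * t)%g <= d s t.

Definition proper_metric (R : realType) (S : invSemigroupType)
    (d : S -> S -> \bar R) :=
  forall r : R, (0 <= r)%R -> exists2 F : set S, finite_set F &
    forall x y, x <> y -> d x y <= r%:E -> exists2 f, F f & y = (x * f)%g.

Definition standard_metric (R : realType) (S : invSemigroupType)
    (d : S -> S -> \bar R) : Prop :=
  [/\ extended_metric d,
      uniformly_discrete d,
      forall s t, d s t < +oo <-> greenR s t,
      left_subinvariant d &
      proper_metric d].

(* [fine] is harmless: all elements of the group [max_group_image S] are
   R-related, so a standard metric [dG] takes only finite values. *)
Definition unif_bounded_group_distortion (R : realType) (S : invSemigroupType)
    (dS : S -> S -> \bar R)
    (dG : max_group_image S -> max_group_image S -> \bar R) : Prop :=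
  exists2 phi : R -> R, (forall r, (0 <= r)%R -> (0 <= phi r)%R) &
    forall s t, greenR s t ->
      dS s t <= (phi (fine (dG (sigma_hom s) (sigma_hom t))))%:E.

(* Main.v *)
(** Bounded distortion is equivalent to: the non-idempotents of each sigma-class
    lie below a finite set.  If distortion is bounded by [phi], a non-idempotent
    [s] of class [g] is within [phi (dG 1 g)] of [s s^-1], so properness gives
    [s = s s^-1 f <= f] with [f] in a finite set depending only on [g].
    Conversely, if [s R t] then [a = s^-1 t] satisfies [t = s a]; when [a] is
    idempotent [t = s], and when [a <= m] left subinvariance bounds [dS s t] by
    the finite number [dS (m m^-1) m].  The classes of such [a] range over a
    finite set as long as [dG] of the images of [s] and [t] is bounded. *)
Require Import Defs.
From mathcomp Require Import all_boot all_order all_algebra.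
From mathcomp Require Import all_classical all_reals all_analysis.

Local Open Scope classical_set_scope.

Set Implicit Arguments.
Unset Strict Implicit.

Import Order.TTheory GRing.Theory Num.Theory.

(** * Idempotents and inverses *)

Section InverseSemigroupTheory.
Local Open Scope group_scope.
Variable S : invSemigroupType.
Implicit Types e f s t u : S.

Lemma sinvK s : sinv (sinv s) = s.
Proof. by symmetry; apply: sinv_uniq; rewrite ?mulVsV ?mulsVs. Qed.

Lemma sinv_idem e : idempotents S e -> sinv e = e.
Proof. by move=> ee; symmetry; apply: sinv_uniq; rewrite !ee. Qed.

(** Uniqueness of inverses gives [f * x * e = x], which makes [x] idempotent; hence [x] is its own
    inverse, and that inverse is [e * f]. *)
Lemma idemM e f : idempotents S e -> idempotents S f -> idempotents S (e * f).
Proof.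
move=> ee ff; set x := sinv (e * f).
have xE : f * x * e = x.
  apply: sinv_uniq.
    rewrite !mulgA -(mulgA e f f) ff -(mulgA _ e e) ee.
    by rewrite -(mulgA (e * f * x)) mulsVs.
  rewrite !mulgA -(mulgA _ e e) ee -(mulgA _ f f) ff.
  by rewrite -(mulgA _ e f) -(mulgA f x) -(mulgA f) mulVsV.
have xx : idempotents S x.
  rewrite /idempotents /= -{1 2}xE !mulgA -(mulgA _ e f).
  by rewrite -(mulgA f x) -(mulgA f) mulVsV xE.
by rewrite -(sinvK (e * f)) -/x sinv_idem.
Qed.

(** Both products are idempotent, and [e * f] is an inverse of [f * e], which is its own inverse. *)
Lemma idemC e f : idempotents S e -> idempotents S f -> e * f = f * e.
Proof.
move=> ee ff; have eff := idemM ee ff; have fee := idemM ff ee.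
rewrite -(sinv_idem fee); apply: sinv_uniq.
  rewrite !mulgA -(mulgA _ e e) ee -(mulgA _ f f) ff.
  by rewrite -(mulgA (f * e)) fee.
rewrite !mulgA -(mulgA _ f f) ff -(mulgA _ e e) ee.
by rewrite -(mulgA (e * f)) eff.
Qed.

Lemma sinvM s t : sinv (s * t) = sinv t * sinv s.
Proof.
symmetry; apply: sinv_uniq.
  rewrite !mulgA -(mulgA s t) -(mulgA _ (sinv s) s) -(mulgA s).
  rewrite (idemC (idem_mulV t) (idem_mulVs s)) !mulgA mulsVs.
  by rewrite -!mulgA (mulgA t) mulsVs.
rewrite !mulgA -(mulgA _ (sinv s) s) -(mulgA _ t (sinv t)).
rewrite -(mulgA (sinv t) (sinv s * s)).
rewrite (idemC (idem_mulVs s) (idem_mulV t)) !mulgA mulVsV.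
by rewrite -!mulgA (mulgA (sinv s)) mulVsV.
Qed.

Lemma idem_conj s e : idempotents S e -> idempotents S (s * e * sinv s).
Proof.
move=> ee; rewrite /idempotents /= !mulgA -(mulgA (s * e)).
rewrite -(mulgA s e) (idemC ee (idem_mulVs s)) !mulgA mulsVs.
by rewrite -(mulgA s e e) ee.
Qed.

Lemma mulr_idem s e : idempotents S e -> s * e = s * e * sinv s * s.
Proof.
by move=> ee; rewrite -!mulgA (idemC ee (idem_mulVs s)) !mulgA mulsVs.
Qed.

(** An idempotent moves across [s] at the price of conjugation, so the natural order can be defined
    from either side. *)
Lemma mull_idem s e : idempotents S e -> e * s = s * (sinv s * e * s).
Proof.
by move=> ee; rewrite !mulgA (idemC (idem_mulV s) ee) -!mulgA (mulgA s) mulsVs.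
Qed.

(** * The natural partial order *)

Lemma natural_leP s t : natural_le s t <-> s = s * sinv s * t.
Proof.
split=> [[e ee ->]|->].
  rewrite sinvM (sinv_idem ee) !mulgA -(mulgA t e e) ee.
  exact: mulr_idem.
rewrite (mull_idem _ (idem_mulV s)).
exists (sinv t * (s * sinv s) * t) => //.
by rewrite -[t in X in _ * _ * X]sinvK; apply/idem_conj/idem_mulV.
Qed.

Lemma natural_le_mull e s : idempotents S e -> natural_le (e * s) s.
Proof.
move=> ee; rewrite (mull_idem _ ee); exists (sinv s * e * s) => //.
by rewrite -[s in X in _ * _ * X]sinvK; apply: idem_conj.
Qed.

Lemma natural_le_refl s : natural_le s s.
Proof. by exists (sinv s * s); [exact: idem_mulVs|rewrite mulgA mulsVs]. Qed.

Lemma natural_le_trans t s u : natural_le s t -> natural_le t u -> natural_le s u.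
Proof.
by move=> [e ee ->] [f ff ->]; exists (f * e); [exact: idemM|rewrite mulgA].
Qed.

Lemma natural_le_anti s t : natural_le s t -> natural_le t s -> s = t.
Proof.
move=> [e ee sE] [f ff tE].
have se : s * e = s by rewrite sE -mulgA ee.
by rewrite sE tE -mulgA (idemC ff ee) mulgA se.
Qed.

Lemma natural_leM s s' t t' :
  natural_le s s' -> natural_le t t' -> natural_le (s * t) (s' * t').
Proof.
move=> [e ee ->] [f ff ->]; rewrite -mulgA (mulgA e) (mull_idem t' ee).
exists (sinv t' * e * t' * f); last by rewrite !mulgA.
by apply: idemM => //; rewrite -[t' in X in _ * _ * X]sinvK; apply: idem_conj.
Qed.

Lemma natural_leV s t : natural_le s t -> natural_le (sinv s) (sinv t).
Proof.
by move=> [e ee ->]; rewrite sinvM (sinv_idem ee); apply: natural_le_mull.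
Qed.

Lemma idempotents_le s t : natural_le s t -> idempotents S t -> idempotents S s.
Proof. by move=> [e ee ->] tt; apply: idemM. Qed.

Lemma sigma_hom_le s t : natural_le s t -> sigma_hom s = sigma_hom t.
Proof. by move=> [e ee ->]; rewrite sigma_homM; case: (sigma_hom_mul1 (sigma_hom t) ee). Qed.

Lemma sigma_homV s : sinv (sigma_hom s) = sigma_hom (sinv s).
Proof.
symmetry; apply: sinv_uniq.
  by rewrite -(sigma_homM s (sinv s)) -(sigma_homM (s * sinv s)) mulsVs.
by rewrite -(sigma_homM (sinv s) s) -(sigma_homM (sinv s * s)) mulVsV.
Qed.

Lemma ascending_chain_le (u : nat -> S) m n :
  ascending_chain u -> (m <= n)%N -> natural_le (u m) (u n).
Proof.
move=> cu /subnKC <-; elim: (n - m)%N => [|k IH].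
  by rewrite addn0; apply: natural_le_refl.
by rewrite addnS; apply: natural_le_trans IH _; apply: cu.
Qed.

(** If every [b] failed to bound the chain at some index [N b], then at the largest index over the
    finite set the element of [F] above the chain would contradict its own failure. *)
Lemma finite_cofinal_bounded_above (u : nat -> S) (F : set S) :
  finite_set F -> ascending_chain u ->
  (forall n, exists2 f, F f & natural_le (u n) f) -> bounded_above u.
Proof.
move=> /finite_seqP[l ->] cu uF; apply: contrapT => nb.
have /choice[N NP] : forall b, exists n, ~ natural_le (u n) b.
  by move=> b; apply/existsNP => ub; apply: nb; exists b.
have [f /= fl le_f] := uF (\max_(b <- l) N b)%N.
apply: (NP f); apply: natural_le_trans le_f.
by apply: ascending_chain_le => //; exact: leq_bigmax_seq.
Qed.

(** * Countable generation and maximal elements *)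

Section GeneratedCountable.
Variable X : set S.

(** The union of the stages is the inverse subsemigroup generated by [X] alone, without the
    idempotents; the stages make its countability an induction. *)
Fixpoint gen_stage (n : nat) : set S :=
  if n is m.+1 then
    gen_stage m `|` @sinv S @` gen_stage m
    `|` (fun p => p.1 * p.2) @` (gen_stage m `*` gen_stage m)
  else X.

Lemma countable_gen_stage n : countable X -> countable (gen_stage n).
Proof.
move=> cX; elim: n => //= n IH.
have cU (A B : set S) : countable A -> countable B -> countable (A `|` B).
  by move=> cA cB; rewrite -bigcup2E; apply: bigcup_countable => // -[|[|]] /=.
have cI T (A : set T) (f : T -> S) : countable A -> countable (f @` A).
  exact: sub_countable (card_image_le _ _).
exact: cU (cU _ _ IH (cI _ _ _ IH)) (cI _ _ _ (countableX IH IH)).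
Qed.

Lemma gen_stage_le m n : (m <= n)%N -> gen_stage m `<=` gen_stage n.
Proof.
move=> /subnKC <-; elim: (n - m)%N => [|k IH]; first by rewrite addn0.
by move=> s /IH gs; rewrite addnS; left; left.
Qed.

Lemma inverse_subsemigroup_gen_stage :
  inverse_subsemigroup (\bigcup_n gen_stage n).
Proof.
split=> [s t [m _ ms] [n _ nt]|s [m _ ms]].
  exists (maxn m n).+1 => //=; right; exists (s, t) => //=.
  by split; [apply: gen_stage_le ms|apply: gen_stage_le nt];
    rewrite ?leq_maxl ?leq_maxr.
by exists m.+1 => //=; left; right; exists s.
Qed.

End GeneratedCountable.

(** Multiplying by an idempotent on either side only lowers an element. So the elements that are
    idempotent or below [W] form an inverse subsemigroup containing all generators. *)
Lemma quasi_countable_cofinal : quasi_countable S ->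
  exists2 W : set S, countable W &
    forall s, ~ idempotents S s -> exists2 w, W w & natural_le s w.
Proof.
move=> [X cX genX]; set W := \bigcup_n gen_stage X n.
have [WM WV] : inverse_subsemigroup W := inverse_subsemigroup_gen_stage X.
exists W; first by apply: bigcup_countable => // n _; apply: countable_gen_stage.
pose A := [set s | idempotents S s \/ exists2 w, W w & natural_le s w].
suff AT : [set: S] `<=` A by move=> s nes; have [|] := AT s I.
rewrite -genX; apply: smallest_sub; first split.
- move=> a b [ea|[v Wv av]] [eb|[w Ww bw]].
  + by left; apply: idemM.
  + right; exists w => //; apply: natural_le_trans bw; exact: natural_le_mull.
  + right; exists v => //; apply: natural_le_trans av; by exists b.
  + by right; exists (v * w); [exact: WM|exact: natural_leM].
- move=> a [ea|[v Wv av]]; first by left; rewrite sinv_idem.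
  by right; exists (sinv v); [exact: WV|exact: natural_leV].
- move=> a [Xa|ea]; [right|by left].
  by exists a; [exists 0%N|exact: natural_le_refl].
Qed.

(* A greedy chain running through an enumeration of a countable cofinal set
   has only maximal elements as upper bounds, so no uncountable chains need to
   be considered. *)
Lemma le_maximal_nonidempotent : quasi_countable S ->
  (forall u : nat -> S, (forall n, ~ idempotents S (u n)) ->
    ascending_chain u -> bounded_above u) ->
  forall s, ~ idempotents S s ->
    exists m, [/\ natural_le s m, maximal_elt m & ~ idempotents S m].
Proof.
move=> /quasi_countable_cofinal[W /countable_injP[/= num num_inj] Wcof] bdd s nes.
(* The default value [a] keeps the chain in place when the element numbered [n] is not above it. *)
pose next n a := xget a [set w | [/\ W w, num w = n & natural_le a w]].
pose u := fix u n := if n is k.+1 then next k (u k) else s.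
have cu : ascending_chain u.
  move=> n /=; rewrite /next; case: xgetP => [w _ [] //|_].
  exact: natural_le_refl.
have neu n : ~ idempotents S (u n).
  apply: contra_not nes; apply: idempotents_le.
  exact: (@ascending_chain_le u 0).
have [b ub] := bdd u neu cu.
have neb : ~ idempotents S b.
  by move=> eb; apply: (neu 0%N); apply: idempotents_le eb; apply: ub.
exists b; split=> //; first exact: (ub 0%N).
move=> t bt.
have net : ~ idempotents S t by apply: contra_not neb; apply: idempotents_le.
have [w Ww tw] := Wcof t net.
have uw : natural_le (u (num w)) w.
  exact: natural_le_trans (ub _) (natural_le_trans bt tw).
(* At step [num w] the element [w] was eligible, and injectivity of [num] leaves no other choice;
   thus [t] lies below a term of the chain, hence below [b]. *)
have uSw : u (num w).+1 = w.
  rewrite /= /next; case: xgetP => [w' -> [Ww' nw' _]|/(_ w)[]//].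
  by apply: num_inj => //; rewrite inE.
apply: natural_le_anti bt; apply: natural_le_trans tw _.
by rewrite -uSw.
Qed.

End InverseSemigroupTheory.

(** * Bounded distortion and finite cofinal sets *)

Section GroupDistortion.
Local Open Scope group_scope.
Variables (R : realType) (S : invSemigroupType) (dS : S -> S -> \bar R).
Variable dG : max_group_image S -> max_group_image S -> \bar R.
Hypotheses (std_dS : standard_metric dS) (std_dG : standard_metric dG).

Lemma greenR_mulV (s : S) : greenR (s * sinv s) s.
Proof. by rewrite /greenR (sinv_idem (idem_mulV s)) (idem_mulV s). Qed.

Lemma greenR_group (g h : max_group_image S) : greenR g h.
Proof.
rewrite /greenR -(sigma_hom_repr g) -(sigma_hom_repr h) !sigma_homV.
rewrite -(sigma_homM (repr g)) -(sigma_homM (repr h)).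
by apply/sigma_homP; exact: sigma_idem (idem_mulV _) (idem_mulV _).
Qed.

Lemma unif_bounded_finite_cofinal : unif_bounded_group_distortion dS dG ->
  forall g, exists2 F : set S, finite_set F &
    forall s, sigma_hom s = g -> ~ idempotents S s ->
      exists2 f, F f & natural_le s f.
Proof.
move=> [phi phi_ge0 dS_le] g; case: std_dG => -[dG_ge0 _ _ _] _ _ _ _.
case: std_dS => _ _ _ _ proper_dS.
(* Any idempotent maps to the identity of the group, so [r] depends on [g] only. *)
set e := repr g * sinv (repr g); set r := phi (fine (dG (sigma_hom e) g)).
have [F finF FP] := proper_dS r (phi_ge0 _ (fine_ge0 (dG_ge0 _ _))).
exists F => // s sg nes.
have [||f Ff sE] := FP (s * sinv s) s.
- by move=> se; apply: nes; rewrite -se; apply: idem_mulV.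
- apply: le_trans (dS_le _ _ (greenR_mulV s)) _; rewrite lee_fin sg.
  by have /sigma_homP -> := sigma_idem (idem_mulV s) (idem_mulV (repr g)).
by exists f => //; rewrite sE; apply/natural_le_mull/idem_mulV.
Qed.

Lemma finite_dist_mulV_bounded (M : set S) : finite_set M ->
  exists2 B : R, (0 <= B)%R &
    forall m, M m -> (dS (m * sinv m)%g m <= B%:E)%E.
Proof.
case: std_dS => -[dS_ge0 _ _ _] _ dS_fin _ _ /finite_seqP[l ->].
exists (\big[Num.max/0%R]_(m <- l) fine (dS (m * sinv m) m)).
  exact: bigmax_ge_id.
move=> m /= ml; rewrite -[leLHS]fineK; last first.
  by rewrite ge0_fin_numE //; apply/dS_fin/greenR_mulV.
rewrite lee_fin.
exact: (le_bigmax_seq 0%R m xpredT (fun m => fine (dS (m * sinv m) m))).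
Qed.

(* With [a := sinv s * t], left translation by [s] maps the pair
   [(a * sinv a, a)] to [(s, t)], and left translation by [a * sinv a] maps
   [(m * sinv m, m)] to [(a * sinv a, a)]. *)
Lemma dist_le_mulV (s t m : S) : greenR s t -> natural_le (sinv s * t) m ->
  (dS s t <= dS (m * sinv m)%g m)%E.
Proof.
case: std_dS => _ _ _ dS_sub _ Rst; set a := sinv s * t => am.
have aa : a * sinv a = sinv s * s.
  by rewrite sinvM sinvK !mulgA -(mulgA (sinv s) t) -Rst !mulgA mulVsV.
have -> : dS s t = dS (s * (a * sinv a)) (s * a).
  by rewrite aa !mulgA mulsVs Rst mulsVs.
apply: le_trans (dS_sub _ _ s) _.
have -> : dS (a * sinv a) a = dS (a * sinv a * (m * sinv m)) (a * sinv a * m).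
  rewrite -(natural_leP a m).1 //; congr (dS _ _).
  have /natural_leP := natural_leM am (natural_leV am).
  by rewrite (sinv_idem (idem_mulV a)) (idem_mulV a).
exact: dS_sub.
Qed.

Lemma finite_cofinal_unif_bounded :
  (forall g, exists2 M : set S, finite_set M &
    forall s, sigma_hom s = g -> ~ idempotents S s ->
      exists2 m, M m & natural_le s m) ->
  unif_bounded_group_distortion dS dG.
Proof.
move=> cof.
have /choice[M MP] : forall g, exists M : set S, finite_set M /\
    forall s, sigma_hom s = g -> ~ idempotents S s ->
      exists2 m, M m & natural_le s m.
  by move=> g; have [M] := cof g; exists M.
case: std_dG => -[dG_ge0 _ _ _] _ dG_fin _ proper_dG.
suff /choice[phi phiP] : forall r : R, exists B : R, (0 <= B)%R /\
    ((0 <= r)%R -> forall s t, greenR s t ->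
      (dG (sigma_hom s) (sigma_hom t) <= r%:E)%E -> (dS s t <= B%:E)%E).
  exists phi => [r _|s t Rst]; first by case: (phiP r).
  have [_] := phiP (fine (dG (sigma_hom s) (sigma_hom t))); apply=> //.
    exact: fine_ge0.
  by rewrite fineK // ge0_fin_numE //; apply/dG_fin/greenR_group.
move=> r.
(* An element is needed to name the identity of the group; the empty semigroup is trivial. *)
have [[s0 _]|S0] := pselect (exists s : S, True); last first.
  by exists 0%R; split=> // _ s; case: S0; exists s.
have [r0|] := pselect (0 <= r)%R; last by exists 0%R; split.
have [F finF FP] := proper_dG r r0.
(* Properness only speaks of distinct points, so the identity class is added to [F] for the case of
   equal images. *)
set one := sigma_hom (s0 * sinv s0).
have [|B B0 BP] := @finite_dist_mulV_bounded (\bigcup_(h in one |` F) M h).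
  by apply: bigcup_finite => [|h _]; [rewrite finite_setU|case: (MP h)].
exists B; split=> // _ s t Rst dst; set a := sinv s * t.
have Fa : (one |` F) (sigma_hom a).
  have [st|/eqP st] := eqVneq (sigma_hom s) (sigma_hom t).
    left; rewrite /= sigma_homM -st -(sigma_homM (sinv s)).
    by apply/sigma_homP; exact: sigma_idem (idem_mulVs _) (idem_mulV _).
  right; have [f Ff tE] := FP _ _ st dst.
  rewrite sigma_homM tE mulgA -(sigma_homM (sinv s)).
  by have [-> _] := sigma_hom_mul1 f (idem_mulVs s).
have [ea|nea] := pselect (idempotents S a); last first.
  have [m Mm am] := (MP _).2 a erefl nea.
  by apply: le_trans (dist_le_mulV Rst am) (BP m _); exists (sigma_hom a).
(* An idempotent [a] gives [t <= s], and R-related comparable elements coincide. *)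
suff -> : s = t.
  by case: std_dS => -[_ /(_ t t)[_ ->]].
have tE : t = s * a by rewrite mulgA Rst mulsVs.
have /natural_leP : natural_le t s by exists a.
by rewrite -Rst mulsVs.
Qed.

End GroupDistortion.

(** The maximal element found above [s] stays in the class of [s], since comparable elements have
    the same image. *)
Lemma le_finite_maximal (S : invSemigroupType) : quasi_countable S ->
  (forall g : max_group_image S, finite_set (sigma_class g `&`
     [set s | maximal_elt s /\ ~ idempotents S s])) ->
  (forall u : nat -> S, (forall n, ~ idempotents S (u n)) ->
     ascending_chain u -> bounded_above u) ->
  forall g, exists2 M : set S, finite_set M &
    forall s, sigma_hom s = g -> ~ idempotents S s ->
      exists2 m, M m & natural_le s m.
Proof.
move=> qc fin bdd g; exists (sigma_class g `&`
  [set s | maximal_elt s /\ ~ idempotents S s]) => // s sg nes.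
have [m [sm maxm nem]] := le_maximal_nonidempotent qc bdd nes.
by exists m => //; split=> //; rewrite /sigma_class /= -(sigma_hom_le sm).
Qed.

Theorem theorem4p7 (R : realType) :
  (forall (S : invMonoidType) (dS : S -> S -> \bar R)
      (dG : max_group_image S -> max_group_image S -> \bar R),
    quasi_countable S -> standard_metric dS -> standard_metric dG ->
    (unif_bounded_group_distortion dS dG <->
      (forall g : max_group_image S,
         finite_set (sigma_class g `&` [set s | maximal_elt s])) /\
      (forall u : nat -> S, ascending_chain u -> bounded_above u)))
  /\
  (forall (S : invSemigroupType) (dS : S -> S -> \bar R)
      (dG : max_group_image S -> max_group_image S -> \bar R),
    quasi_countable S -> standard_metric dS -> standard_metric dG ->
    (unif_bounded_group_distortion dS dG <->
      (forall g : max_group_image S,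
         finite_set (sigma_class g `&`
           [set s | maximal_elt s /\ ~ idempotents S s])) /\
      (forall u : nat -> S, (forall n, ~ idempotents S (u n)) ->
         ascending_chain u -> bounded_above u))).
Proof.
split=> S dS dG qc stdS stdG; split.
- move=> /(unif_bounded_finite_cofinal stdS stdG) cof.
  (* In a monoid every idempotent lies below [1], so adding [1] to [F] removes the restriction to
     non-idempotents. *)
  have {}cof g : exists2 F : set S, finite_set F &
      forall s, sigma_hom s = g -> exists2 f, F f & natural_le s f.
    have [F finF FP] := cof g; exists (1%g |` F); first by rewrite finite_setU.
    move=> s sg; have [es|nes] := pselect (idempotents S s).
      by exists 1%g; [left|exists s; rewrite ?mul1g].
    by have [f Ff sf] := FP s sg nes; exists f; [right|].
  split=> [g|u cu].
    have [F finF FP] := cof g; apply: sub_finite_set finF => s [sg maxs].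
    (* A maximal element equals the element of [F] above it. *)
    by have [f Ff /maxs <-] := FP s sg.
  (* The whole chain lies in the class of its first term, so one finite set serves all terms. *)
  have [F finF FP] := cof (sigma_hom (u 0%N)).
  apply: (finite_cofinal_bounded_above finF cu) => n; apply: FP.
  exact: esym (sigma_hom_le (ascending_chain_le cu (leq0n n))).
- move=> [fin bdd]; apply: finite_cofinal_unif_bounded => //.
  apply: le_finite_maximal => // [g|u _]; last exact: bdd.
  by apply: sub_finite_set (fin g) => s [sg []].
- move=> /(unif_bounded_finite_cofinal stdS stdG) cof; split=> [g|u neu cu].
    have [F finF FP] := cof g; apply: sub_finite_set finF => s [sg [maxs nes]].
    by have [f Ff /maxs <-] := FP s sg nes.
  have [F finF FP] := cof (sigma_hom (u 0%N)).
  apply: (finite_cofinal_bounded_above finF cu) => n; apply: FP => //.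
  exact: esym (sigma_hom_le (ascending_chain_le cu (leq0n n))).
- move=> [fin bdd]; apply: finite_cofinal_unif_bounded => //.
  exact: le_finite_maximal.
Qed.
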